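(* Let $k\ge1$ be an integer and let $E\in V_k\Lambda^1(K)$ be a polynomial 1-form for which all the degrees of freedom $\Sigma^{k,1}(K)$ vanish. Then $E\equiv0$.
   Context: $K\subset\mathbb R^4$ is the pentatope (4-simplex) with vertices $(0,0,0,0),(1,0,0,0),(0,1,0,0),(0,0,1,0),(0,0,0,1)$; it has 10 edges, 10 triangular faces, 5 tetrahedral facets. $P^j$ denotes polynomials of total degree $\le j$ on the indicated set ($\{0\}$ if $j<0$), $\tilde P^k$ homogeneous polynomials of degree exactly $k$ (together with $0$), and $$V_k\Lambda^1(K)=(P^{k-1}(K))^4\oplus\{p\in(\tilde P^k(K))^4: p\cdot x=0\}.$$ Degrees of freedom $\Sigma^{k,1}(K)$ of $E$: - $\int_e (E\cdot\tau)\,q$, $q\in P^{k-1}(e)$, for each edge $e$ with unit tangent $\tau$; - $\int_f E\cdot q$ for each triangular face $f$ and each vector field $q$ tangent to $f$ with components in $P^{k-2}(f)$; - $\int_{\mathcal F}E\cdot q$ for each tetrahedral facet $\mathcal F$ and each vector field $q$ tangent to $\mathcal F$ with components in $P^{k-3}(\mathcal F)$; - $\int_KE\cdot q$, $q\in(P^{k-4}(K))^4$. *)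

(* Defs.v *)
From HB Require Import structures.
From mathcomp Require Import all_boot all_order all_algebra.
From mathcomp Require mpoly.
From mathcomp Require Import all_classical all_reals all_analysis.

Set Implicit Arguments.
Unset Strict Implicit.
Unset Printing Implicit Defensive.

Import Order.TTheory GRing.Theory Num.Theory.
Import numFieldNormedType.Exports.

Local Open Scope classical_set_scope.
Local Open Scope ring_scope.

(* R^d with its d-dimensional Lebesgue measure. The carrier is the iterated
   product R * (R * ... (R * unit)), because the library puts no measure on
   'rV[R]_d; lcoord reads a point of the carrier as a row vector. *)
Record lebesgue_space (R : realType) (d : nat) := LebesgueSpace {
  ldisp : measure_display;
  lcarrier : measurableType ldisp;
  lmeasure : {sigma_finite_measure set lcarrier -> \bar R};
  lcoord : lcarrier -> 'rV[R]_d }.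

(* An alias of the library's product measure. It carries its own instances
   because the sigma-finite instance of the library is declared on m1 \x m2 and
   is then shadowed by the one for products of subprobabilities. *)
Section ProductMeasure.
Context d1 d2 (T1 : measurableType d1) (T2 : measurableType d2) (R : realType).
Variables (m1 : {sigma_finite_measure set T1 -> \bar R})
          (m2 : {sigma_finite_measure set T2 -> \bar R}).

Definition prod_measure : set (T1 * T2) -> \bar R := (m1 \x m2)%E.

HB.instance Definition _ := Measure.on prod_measure.

Let prod_measure_sigma_finite : sigma_finite setT prod_measure.
Proof.
have /sigma_finiteP[F [TF ndF Foo]] := sigma_finiteT m1.
have /sigma_finiteP[G [TG ndG Goo]] := sigma_finiteT m2.
exists (fun n => F n `*` G n).
  rewrite -setXTT TF TG predeqE => -[x y]; split.
    move=> [/= [n _ Fnx] [k _ Gky]]; exists (maxn n k) => //; split.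
    - by move: x Fnx; exact/subsetPset/ndF/leq_maxl.
    - by move: y Gky; exact/subsetPset/ndG/leq_maxr.
  by move=> [n _ []/= ? ?]; split; exists n.
move=> k; have [? ?] := Foo k; have [? ?] := Goo k.
split; first exact: measurableX.
by rewrite /prod_measure product_measure1E// lte_mul_pinfty// ge0_fin_numE.
Qed.

HB.instance Definition _ := Measure_isSigmaFinite.Build _ _ _ prod_measure
  prod_measure_sigma_finite.
End ProductMeasure.

Fixpoint leb (R : realType) (d : nat) : lebesgue_space R d :=
  match d return lebesgue_space R d with
  | 0%N => @LebesgueSpace R 0 _ unit (@dirac _ unit tt R) (fun=> 0)
  | n.+1 => @LebesgueSpace R n.+1 _ (measurableTypeR R * lcarrier (leb R n))%type
      (prod_measure (@lebesgue_measure R) (lmeasure (leb R n)))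
      (fun t => row_mx (t.1)%:M (lcoord t.2) : 'rV[R]_(1 + n))
  end.

Section Definitions.
Variable R : realType.
Local Notation vec := 'rV[R]_4.

Definition dot (u v : vec) : R := (u *m v^T) 0 0.

(* f is the restriction to A of a polynomial of total degree <= j; the degree
   is an integer, and for j < 0 only f = 0 on A qualifies. *)
Definition is_poly (j : int) (A : set vec) (f : vec -> R) : Prop :=
  exists2 p : mpoly.mpoly 4 R,
    all (fun m => (mpoly.mdeg m)%:Z <= j) (mpoly.msupp p) &
    forall x, A x -> f x = mpoly.meval (x 0) p.

Definition is_homog_poly (k : nat) (A : set vec) (f : vec -> R) : Prop :=
  exists2 p : mpoly.mpoly 4 R,
    all (fun m => mpoly.mdeg m == k) (mpoly.msupp p) &
    forall x, A x -> f x = mpoly.meval (x 0) p.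

Definition is_poly_field (j : int) (A : set vec) (q : vec -> vec) : Prop :=
  forall i, is_poly j A (fun x => q x 0 i).

Definition is_homog_field (k : nat) (A : set vec) (q : vec -> vec) : Prop :=
  forall i, is_homog_poly k A (fun x => q x 0 i).

(* A d-simplex of R^4 is given by the family a of its d + 1 vertices. *)
Definition simplex d (a : 'I_d.+1 -> vec) : set vec :=
  [set x | exists w : 'I_d.+1 -> R,
    [/\ forall i, 0 <= w i, \sum_i w i = 1 & x = \sum_i w i *: a i]].

(* The rows are a basis of the directions tangent to the simplex. *)
Definition dir_mx d (a : 'I_d.+1 -> vec) : 'M[R]_(d, 4) :=
  \matrix_(i < d) (a (lift ord0 i) - a ord0).

Definition tangent_field d (a : 'I_d.+1 -> vec) (q : vec -> vec) : Prop :=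
  forall x, simplex a x -> (q x <= dir_mx a)%MS.

Definition unit_tangent (a : 'I_2 -> vec) : vec :=
  let v := a ord_max - a ord0 in (Num.sqrt (dot v v))^-1 *: v.

Definition std_simplex d : set 'rV[R]_d :=
  [set t | (forall i, 0 <= t 0 i) /\ \sum_i t 0 i <= 1].

(* Integral with respect to d-dimensional surface measure, through the affine
   parametrization t |-> a ord0 + t *m dir_mx a of the simplex by the standard
   d-simplex; the factor is the square root of the Gram determinant. *)
Definition int_simplex d (a : 'I_d.+1 -> vec) (g : vec -> R) : R :=
  Num.sqrt (\det (dir_mx a *m (dir_mx a)^T)) *
  \int[lmeasure (leb R d)]_(t in @lcoord R d (leb R d) @^-1` @std_simplex d)
    g (a ord0 + lcoord t *m dir_mx a).

Definition pent_vertex (i : 'I_5) : vec :=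
  if unlift ord0 i is Some j then delta_mx 0 j else 0.

Definition pentatope : set vec := simplex pent_vertex.

(* Increasing s, so that every d-face of the pentatope occurs exactly once. *)
Definition is_face d (a : 'I_d.+1 -> vec) : Prop :=
  exists2 s : 'I_d.+1 -> 'I_5,
    {homo s : i j / (i < j)%N} & a = pent_vertex \o s.

Definition VLambda1 (k : nat) (E : vec -> vec) : Prop :=
  exists p h : vec -> vec,
    [/\ is_poly_field (k%:Z - 1) pentatope p,
        is_homog_field k pentatope h,
        forall x, pentatope x -> dot (h x) x = 0
      & forall x, pentatope x -> E x = p x + h x].

Definition edge_dofs_vanish (k : nat) (E : vec -> vec) : Prop :=
  forall e : 'I_2 -> vec, is_face e ->
  forall q : vec -> R, is_poly (k%:Z - 1) (simplex e) q ->
    int_simplex e (fun x => dot (E x) (unit_tangent e) * q x) = 0.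

Definition triangle_dofs_vanish (k : nat) (E : vec -> vec) : Prop :=
  forall f : 'I_3 -> vec, is_face f ->
  forall q : vec -> vec, is_poly_field (k%:Z - 2) (simplex f) q ->
    tangent_field f q ->
    int_simplex f (fun x => dot (E x) (q x)) = 0.

Definition facet_dofs_vanish (k : nat) (E : vec -> vec) : Prop :=
  forall F : 'I_4 -> vec, is_face F ->
  forall q : vec -> vec, is_poly_field (k%:Z - 3) (simplex F) q ->
    tangent_field F q ->
    int_simplex F (fun x => dot (E x) (q x)) = 0.

Definition interior_dofs_vanish (k : nat) (E : vec -> vec) : Prop :=
  forall q : vec -> vec, is_poly_field (k%:Z - 4) pentatope q ->
    int_simplex pent_vertex (fun x => dot (E x) (q x)) = 0.

Definition dofs_vanish (k : nat) (E : vec -> vec) : Prop :=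
  [/\ edge_dofs_vanish k E, triangle_dofs_vanish k E,
      facet_dofs_vanish k E & interior_dofs_vanish k E].

End Definitions.

(* Main.v *)
Require Import Defs.
From mathcomp Require Import all_boot all_order all_algebra.
From mathcomp Require Import all_classical all_reals all_analysis measurable_realfun.
From mathcomp Require Import zify.
From mathcomp Require Import ring lra.
From mathcomp Require Import -(notations) mpoly.

Set Implicit Arguments.
Unset Strict Implicit.
Unset Printing Implicit Defensive.

Import Order.TTheory GRing.Theory Num.Theory.
Import numFieldNormedType.Exports.

Local Open Scope classical_set_scope.
Local Open Scope ring_scope.

(** A form E in the first-kind space vanishes on the pentatope because its
    tangential traces vanish on the faces of dimension 0, 1, 2, 3 and 4 in turn.
    In each dimension this is the same statement about the standard d-simplex:
    a first-kind form u of degree k with vanishing tangential traces on all facets,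
    orthogonal to the fields of degree k - d, is zero ([zero_trace_unisolvence]).

    Its proof needs no exterior derivative, only divisibility and positivity.
    Write t_1, ..., t_d for the coordinates and lam0 = 1 - sum_i t_i.  The vanishing
    traces, together with the degree condition on the radial component
    sum_i t_i u_i, show that
      u = sum_i c_i (prod_(m <> i) t_m) (lam0 dt_i - t_i dlam0)
    for polynomials c_i of degree at most k - d: the coefficients of u on Whitney
    forms multiplied by the complementary barycentric coordinates.  These c_i are
    admissible test functions, and sum_i u_i c_i is a sum of squares with weights
    that are positive inside the simplex.  Its integral is zero, hence
    c = 0 and u = 0.

    To pass between faces, the first-kind space is described as the space of
    fields e of degree at most k whose radial component sum_l x_l e_l also has
    degree at most k ([VLambda1_poly]).  This is stable under affine pullback
    ([trace_vanish_step]), and polynomial test fields on the standard simplex are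
    pullbacks of admissible test fields on the face ([face_dof_pullback]).
    Values on the pentatope determine polynomials everywhere
    ([polyf_interior_eq0]), so that all intermediate identities can be stated for
    polynomial functions on the whole space. *)

(** * Polynomial functions with a degree bound *)

Section PolyFunctions.
Variable R : realType.

(** The degree bound j is an integer, as in [is_poly]: for j < 0 only the zero
    function qualifies, which is what makes the test spaces of negative degree
    trivial without any case distinction. *)
Definition polyf d (j : int) (f : 'rV[R]_d -> R) : Prop :=
  exists2 p : mpoly d R,
    all (fun m => (mdeg m)%:Z <= j) (msupp p) & forall x, f x = meval (x 0) p.

Lemma polyf_ext d j (f g : 'rV[R]_d -> R) : f =1 g -> polyf j f -> polyf j g.
Proof. by move=> fg [p pj pf]; exists p => // x; rewrite -fg. Qed.

Lemma polyfW d i j (f : 'rV[R]_d -> R) : i <= j -> polyf i f -> polyf j f.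
Proof.
move=> ij [p pi pf]; exists p => //.
by apply: sub_all pi => m /= /le_trans; exact.
Qed.

Lemma polyf0 d j : polyf j (fun _ : 'rV[R]_d => 0).
Proof. by exists 0; rewrite ?msupp0 // => x; rewrite meval0. Qed.

Lemma polyf_cst d j (c : R) : 0 <= j -> polyf j (fun _ : 'rV[R]_d => c).
Proof.
move=> j0; exists (mpolyC d c) => [|x]; last by rewrite mevalC.
by rewrite msuppC; case: ifP => //= _; rewrite mdeg0 andbT.
Qed.

Lemma polyf_coord d j (i : 'I_d) : 1 <= j -> polyf j (fun x : 'rV[R]_d => x 0 i).
Proof.
move=> j1; exists (mpolyX R (mnm1 i)) => [|x]; last by rewrite mevalXU.
by rewrite msuppX /= mdeg1 andbT.
Qed.

Lemma polyfD d j (f g : 'rV[R]_d -> R) :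
  polyf j f -> polyf j g -> polyf j (fun x => f x + g x).
Proof.
move=> [p pj pf] [q qj qg]; exists (p + q) => [|x]; last by rewrite mevalD pf qg.
apply/allP => m /msuppD_le; rewrite mem_cat => /orP[]; last exact: (allP qj).
exact: (allP pj).
Qed.

Lemma polyfM d i j (f g : 'rV[R]_d -> R) :
  polyf i f -> polyf j g -> polyf (i + j) (fun x => f x * g x).
Proof.
move=> [p pj pf] [q qj qg]; exists (p * q) => [|x]; last by rewrite mevalM pf qg.
apply/allP => m /msuppM_le /allpairsP[[m1 m2] /= [m1p m2q ->]].
by rewrite mdegD PoszD lerD ?(allP pj) ?(allP qj).
Qed.

Lemma polyfZ d j c (f : 'rV[R]_d -> R) : polyf j f -> polyf j (fun x => c * f x).
Proof.
by move=> pf; rewrite -[j]add0r; apply: polyfM => //; apply: polyf_cst.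
Qed.

Lemma polyfB d j (f g : 'rV[R]_d -> R) :
  polyf j f -> polyf j g -> polyf j (fun x => f x - g x).
Proof.
move=> pf pg; apply: (@polyf_ext _ _ (fun x => f x + (-1) * g x)).
  by move=> x; rewrite mulN1r.
by apply: polyfD => //; apply: polyfZ.
Qed.

Lemma polyf_sum d j (I : Type) (r : seq I) (P : pred I) (F : I -> 'rV[R]_d -> R) :
  (forall i, P i -> polyf j (F i)) -> polyf j (fun x => \sum_(i <- r | P i) F i x).
Proof.
move=> PF; elim: r => [|i r IH].
  by apply: polyf_ext (polyf0 d j) => x; rewrite big_nil.
case: (boolP (P i)) => Pi; last first.
  by apply: polyf_ext IH => x; rewrite big_cons (negPf Pi).
by apply: polyf_ext (polyfD (PF _ Pi) IH) => x; rewrite big_cons Pi.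
Qed.

Lemma polyf_prod d (I : Type) (r : seq I) (P : pred I) (e : I -> int)
    (F : I -> 'rV[R]_d -> R) :
  (forall i, P i -> polyf (e i) (F i)) ->
  polyf (\sum_(i <- r | P i) e i) (fun x => \prod_(i <- r | P i) F i x).
Proof.
move=> PF; elim: r => [|i r IH].
  rewrite big_nil; apply: (@polyf_ext _ _ (fun=> 1)) => [x|]; first by rewrite big_nil.
  exact: polyf_cst.
rewrite big_cons; case: (boolP (P i)) => Pi; last first.
  by apply: polyf_ext IH => x; rewrite big_cons (negPf Pi).
by apply: polyf_ext (polyfM (PF _ Pi) IH) => x; rewrite big_cons Pi.
Qed.

Lemma polyfX d j n (f : 'rV[R]_d -> R) :
  polyf j f -> polyf (j *+ n) (fun x => f x ^+ n).
Proof.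
move=> pf; elim: n => [|n IH]; first by rewrite mulr0n; exact: polyf_cst.
rewrite mulrS; apply: polyf_ext (polyfM pf IH) => x.
by rewrite exprS.
Qed.

Lemma polyf_comp d n j (f : 'rV[R]_d -> R) (A : 'rV[R]_n -> 'rV[R]_d) :
  (forall i, polyf 1 (fun x => A x 0 i)) -> polyf j f -> polyf j (f \o A).
Proof.
move=> PA [p pj pf].
apply: (@polyf_ext _ _ (fun x =>
  \sum_(m <- msupp p) mcoeff m p * \prod_i A x 0 i ^+ m i)).
  by move=> x /=; rewrite pf mevalE.
rewrite [X in polyf _ X](_ : _ = fun x =>
  \sum_(m <- msupp p | m \in msupp p) mcoeff m p * \prod_i A x 0 i ^+ m i); last first.
  by apply/funext => x; rewrite [LHS]big_seq.
apply: polyf_sum => m /(allP pj) mj; apply: polyfZ.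
apply: polyfW mj _.
have -> : (mdeg m)%:Z = \sum_(i < d) 1 *+ m i.
  rewrite mdegE (big_morph Posz PoszD (erefl _)); apply: eq_bigr => i _.
  by rewrite natz.
by apply: polyf_prod => i _; apply: polyfX; exact: PA.
Qed.

(** Continuity, measurability, boundedness on the simplex and polynomiality along
    lines all follow from this principle, because each of them is stable under
    the ring operations. *)
Lemma polyf_ind d (P : ('rV[R]_d -> R) -> Prop) :
  (forall c, P (fun=> c)) -> (forall i, P (fun x => x 0 i)) ->
  (forall f g, P f -> P g -> P (fun x => f x + g x)) ->
  (forall f g, P f -> P g -> P (fun x => f x * g x)) ->
  forall j f, polyf j f -> P f.
Proof.
move=> Pc Pi PD PM j f [p _ pf].
have {pf} -> : f = fun x : 'rV[R]_d =>
    \sum_(m <- msupp p) mcoeff m p * \prod_i x 0 i ^+ m i.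
  by apply/funext => x; rewrite pf mevalE.
elim: (msupp p) => [|m s IH].
  by under eq_fun do rewrite big_nil; exact: Pc.
under eq_fun do rewrite big_cons; apply: (PD) => //; apply: (PM); first exact: Pc.
elim: (index_enum _) => [|i r IHr].
  by under eq_fun do rewrite big_nil; exact: Pc.
under eq_fun do rewrite big_cons; apply: (PM) => //.
elim: (m i) => [|k IHk]; first by under eq_fun do rewrite expr0; exact: Pc.
by under eq_fun do rewrite exprS; apply: (PM).
Qed.

Lemma polyf_line d j (f : 'rV[R]_d -> R) (a v : 'rV[R]_d) : polyf j f ->
  exists P : {poly R}, forall s, P.[s] = f (a + s *: v).
Proof.
move: j f; apply: polyf_ind => [c|i|f g [P Pf] [Q Qg]|f g [P Pf] [Q Qg]].
- by exists c%:P => s; rewrite hornerC.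
- by exists ((a 0 i)%:P + 'X * (v 0 i)%:P) => s; rewrite !hornerE !mxE.
- by exists (P + Q) => s; rewrite hornerD Pf Qg.
- by exists (P * Q) => s; rewrite hornerM Pf Qg.
Qed.

Definition simplex_interior d (t : 'rV[R]_d) := (forall i, 0 < t 0 i) /\ \sum_i t 0 i < 1.

(** Join x to the barycenter c of the standard simplex: along this
    line f is a polynomial in one variable which vanishes near c, hence
    everywhere.  This is the cancellation tool of the file: a factor that is
    positive inside the simplex can be divided out of a polynomial identity. *)
Lemma polyf_interior_eq0 d j (f : 'rV[R]_d -> R) : polyf j f ->
  (forall t, simplex_interior t -> f t = 0) -> forall x, f x = 0.
Proof.
move=> pf f0 x.
(* The equal weights 1/(d+1) leave the same slack 1/(d+1) in all d+1
   inequalities that define the interior. *)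
pose c : 'rV[R]_d := const_mx (d.+1%:R^-1).
have [P Pf] := polyf_line c (x - c) pf.
pose M := \sum_i `|x 0 i - c 0 i| + 1.
have M0 : 0 < M by rewrite ltr_wpDl ?sumr_ge0.
(* These parameters keep every perturbation below the slack, and there are
   infinitely many of them. *)
pose tau (n : nat) : R := (d.+1%:R * (M + n%:R))^-1.
have Mn0 n : 0 < M + n%:R by rewrite ltr_wpDr.
have tau0 n : 0 < tau n by rewrite invr_gt0 mulr_gt0.
have tauM n : tau n * \sum_i `|x 0 i - c 0 i| < d.+1%:R^-1.
  rewrite /tau invfM -mulrA gtr_pMr ?invr_gt0 //.
  by rewrite mulrC ltr_pdivrMr // mul1r /M -addrA ltrDl ltr_pwDl.
have P0 n : root P (tau n).
  rewrite /root Pf f0 //; split=> [i|].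
    rewrite !mxE; set y := x 0 i - _.
    have h1 : tau n * `|y| < d.+1%:R^-1.
      apply: le_lt_trans (tauM n); rewrite ler_pM2l // (bigD1 i) //= mxE lerDl.
      by rewrite sumr_ge0.
    have h2 : - (tau n * `|y|) <= tau n * y.
      by rewrite -mulrN ler_pM2l // lerNl -normrN ler_norm.
    by rewrite -ltrBlDl sub0r (lt_le_trans _ h2) // ltrN2.
  under eq_bigr do rewrite !mxE.
  rewrite big_split /= sumr_const card_ord -mulr_sumr.
  have -> : (d.+1%:R^-1 : R) *+ d = 1 - d.+1%:R^-1.
    rewrite -(mulr_natl _ d); apply: (mulIf (x := d.+1%:R)); rewrite ?pnatr_eq0 //.
    by rewrite mulrBl mulfVK ?pnatr_eq0 // mulVf ?pnatr_eq0 // -natr1; ring.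
  rewrite -ltrBrDl opprB addrC subrK.
  apply: le_lt_trans (tauM n); rewrite ler_pM2l //; apply: ler_sum => i _.
  by rewrite !mxE ler_norm.
have tauI : injective tau.
  move=> m n /invr_inj /(mulfI _); rewrite pnatr_eq0 => /(_ isT) /addrI /eqP.
  by rewrite eqr_nat => /eqP.
have : P = 0.
  apply/eqP/negPn/negP => Pn0.
  have := max_poly_roots (rs := mkseq tau (size P)) Pn0.
  rewrite mkseq_uniq // size_mkseq ltnn => /(_ _ isT) F.
  by suff: false by []; apply: F; apply/allP => _ /mapP[n _ ->].
move=> P_0; have := Pf 1; rewrite P_0 horner0 scale1r addrC subrK.
by move=> <-.
Qed.

End PolyFunctions.

(** * Integrals of polynomials over the standard simplex *)

Section Measure.
Variable R : realType.
Local Notation mu d := (lmeasure (leb R d)).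

Lemma lcoord_head d (t : lcarrier (leb R d.+1)) : lcoord t 0 ord0 = t.1.
Proof.
transitivity ((row_mx (t.1)%:M (lcoord t.2) : 'rV_(1 + d)) 0 (lshift d ord0)).
  by congr (_ 0 _); apply: val_inj.
by rewrite row_mxEl mxE eqxx mulr1n.
Qed.

Lemma lcoord_tail d (t : lcarrier (leb R d.+1)) (i : 'I_d) :
  lcoord t 0 (lift ord0 i) = lcoord t.2 0 i.
Proof.
transitivity ((row_mx (t.1)%:M (lcoord t.2) : 'rV_(1 + d)) 0 (rshift 1 i)).
  by congr (_ 0 _); apply: val_inj.
by rewrite row_mxEr.
Qed.

Lemma measurable_lcoord d (i : 'I_d) :
  measurable_fun setT (fun t : lcarrier (leb R d) => lcoord t 0 i : R).
Proof.
elim: d i => [[]//|d IH] i.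
case: (unliftP ord0 i) => [j|] ->.
  under eq_fun do rewrite lcoord_tail.
  exact: measurableT_comp (IH j) measurable_snd.
under eq_fun do rewrite lcoord_head.
exact: measurable_fst.
Qed.

Lemma measurable_polyf d j (f : 'rV[R]_d -> R) : polyf j f ->
  measurable_fun setT (fun t : lcarrier (leb R d) => f (lcoord t)).
Proof.
move: j f; apply: polyf_ind => [c|i|f g Mf Mg|f g Mf Mg].
- exact: measurable_cst.
- exact: measurable_lcoord.
- exact: measurable_funD.
- exact: measurable_funM.
Qed.

Lemma continuous_polyf d j (f : 'rV[R]_d -> R) : polyf j f -> continuous f.
Proof.
move: j f; apply: polyf_ind => [c|i|f g Mf Mg|f g Mf Mg] x.
- exact: (@cst_continuous _ _ c x).
- exact: coord_continuous.
- exact: (continuousD (Mf x) (Mg x)).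
- exact: (continuousM (Mf x) (Mg x)).
Qed.

Lemma bounded_polyf d j (f : 'rV[R]_d -> R) : polyf j f ->
  exists M, forall t, std_simplex t -> `|f t| <= M.
Proof.
move: j f; apply: polyf_ind => [c|i|f g [M Mf] [N Ng]|f g [M Mf] [N Ng]].
- by exists `|c|.
- exists 1 => t [t0 t1]; rewrite ger0_norm //.
  apply: le_trans t1; rewrite (bigD1 i) //= lerDl; exact: sumr_ge0.
- exists (M + N) => t St.
  by apply: le_trans (ler_normD _ _) _; apply: lerD; [exact: Mf|exact: Ng].
- by exists (M * N) => t St; rewrite normrM ler_pM // ?Mf ?Ng.
Qed.

Definition coord_box d (c : 'rV[R]_d) r : set (lcarrier (leb R d)) :=
  [set t | forall i, ball (c 0 i) r (lcoord t 0 i)].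

(** The positive volume of a cube is all that is needed about the Lebesgue measure
    of R^d; it comes from the product structure by induction on d. *)
Lemma coord_box_measure d (c : 'rV[R]_d) r : 0 <= r ->
  measurable (coord_box c r) /\ mu d (coord_box c r) = ((r *+ 2) ^+ d)%:E.
Proof.
move=> r0; elim: d c => [|d IH] c.
  rewrite (_ : coord_box c r = setT); last by apply/seteqP; split => // t _ [].
  by split=> //=; rewrite diracT expr0.
pose c' : 'rV[R]_d := \row_j c 0 (lift ord0 j).
have -> : coord_box c r = ball (c 0 ord0) r `*` coord_box c' r.
  apply/seteqP; split=> [t tc|t [t1 t2] i].
    split=> [|i]; first by rewrite /= -lcoord_head.
    by rewrite mxE -lcoord_tail.
  case: (unliftP ord0 i) => [j|] ->; last by rewrite lcoord_head.
  by rewrite lcoord_tail; move: (t2 j); rewrite mxE.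
have [m1 m2] := IH c'.
split; first by apply: measurableX => //; apply: measurable_ball.
rewrite /= /prod_measure product_measure1E //; last apply: measurable_ball.
rewrite m2 exprS EFinM; congr (_ * _)%E; exact: lebesgue_measure_ball.
Qed.

Lemma measurable_std_simplex d :
  measurable (@lcoord R d (leb R d) @^-1` @std_simplex R d).
Proof.
rewrite (_ : _ @^-1` _ = (\bigcap_(i in [set: 'I_d])
    ((fun t : lcarrier (leb R d) => lcoord t 0 i : R) @^-1` `[0, +oo[%classic)) `&`
   ((fun t : lcarrier (leb R d) => \sum_i lcoord t 0 i : R) @^-1` `]-oo, 1]%classic)).
  apply: measurableI.
    apply: fin_bigcap_measurable => // i _.
    rewrite -[X in measurable X]setTI.
    by apply: measurable_lcoord.
  rewrite -[X in measurable X]setTI.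
  by apply: measurable_sum => // i; exact: measurable_lcoord.
apply/seteqP; split=> [t [t0 t1]|t [t0 t1]]; split.
- by move=> i _ /=; rewrite in_itv /= t0.
- by rewrite /= in_itv /=.
- by move=> i; move: (t0 i I); rewrite /= in_itv /= andbT.
- by move: t1; rewrite /= in_itv /=.
Qed.

Lemma std_simplex_lt_pinfty d :
  (mu d (@lcoord R d (leb R d) @^-1` @std_simplex R d) < +oo)%E.
Proof.
have [mb vb] := coord_box_measure (0 : 'rV[R]_d) (ler0n _ 2).
apply: (@le_lt_trans _ _ (mu d (coord_box 0 2))); last by rewrite vb ltry.
apply: le_measure; rewrite ?inE //; first exact: measurable_std_simplex.
move=> t [t0 t1] i; rewrite mxE /ball /= sub0r normrN ger0_norm //.
apply: le_lt_trans (_ : 1 < 2); last by rewrite ltr1n.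
by apply: le_trans t1; rewrite (bigD1 i) //= lerDl sumr_ge0.
Qed.

Lemma integrable_polyf d j (f : 'rV[R]_d -> R) : polyf j f ->
  (mu d).-integrable (@lcoord R d (leb R d) @^-1` @std_simplex R d)
    (EFin \o (fun t => f (lcoord t))).
Proof.
move=> pf; apply: measurable_bounded_integrable.
- exact: measurable_std_simplex.
- exact: std_simplex_lt_pinfty.
- by apply: measurable_funTS; exact: measurable_polyf pf.
- have [M Mf] := bounded_polyf pf.
  by exists M; split=> [|N MN t St]; [exact: num_real|exact: le_trans (Mf _ St) (ltW MN)].
Qed.

(** If f were positive at an interior point, it would be bounded below by a
    positive constant on a small cube around it, and the integral would be at
    least this constant times the volume of the cube.  Integrability matters: it
    excludes the value +oo, which a real-valued integral reports as 0. *)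
Lemma polyf_integral_eq0 d j (f : 'rV[R]_d -> R) : polyf j f ->
  (forall t, std_simplex t -> 0 <= f t) ->
  \int[mu d]_(t in @lcoord R d (leb R d) @^-1` @std_simplex R d) f (lcoord t) = 0 ->
  forall t, simplex_interior t -> f t = 0.
Proof.
move=> pf f0 If t [t0 t1]; apply/eqP/negPn/negP => fn0.
have ft0 : 0 < f t.
  by rewrite lt_def fn0 f0 //; split=> [i|]; apply: ltW.
pose D := @lcoord R d (leb R d) @^-1` @std_simplex R d.
have mD : measurable D := @measurable_std_simplex d.
have If0 : (\int[mu d]_(x in D) (f (lcoord x))%:E)%E = 0%E.
  have := integrable_fin_num mD (integrable_polyf pf).
  by move: If; rewrite /Rintegral => If /fineK <-; rewrite If.
have [r /= r0 rP] : exists2 r : R, 0 < r & forall x, ball t r x ->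
    f t / 2 < f x /\ simplex_interior x.
  have N1 : \forall x \near t, f t / 2 < f x.
    have h : f t / 2 < f t by lra.
    exact: (cvgr_gt (f t) (@continuous_polyf _ _ _ pf t) _ h).
  have N2 : \forall x \near t, forall i, 0 < (x : 'rV[R]_d) 0 i.
    apply: (@filter_forall _ 'I_d (fun i (x : 'rV[R]_d) => 0 < x 0 i) (nbhs t)) => i.
    exact: (cvgr_gt (t 0 i) (@coord_continuous R 1 d 0 i t) _ (t0 i)).
  have N3 : \forall x \near t, \sum_i (x : 'rV[R]_d) 0 i < 1.
    have ps : polyf 1 (fun x : 'rV[R]_d => \sum_i x 0 i).
      by apply: polyf_sum => i _; apply: polyf_coord.
    exact: (cvgr_lt _ (@continuous_polyf _ _ _ ps t) _ t1).
  have /nbhs_ballP[r /= r0 rP] : \forall x \near t, f t / 2 < f x /\ simplex_interior x.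
    by near=> x; split; [near: x|split; near: x].
  by exists r.
have [mB vB] := coord_box_measure t (ltW r0).
have rB x : coord_box t r x -> ball t r (lcoord x).
  by move=> xB; split=> // i k; rewrite ord1.
have BD : coord_box t r `<=` D.
  by move=> x /rB /rP[_ [x0 x1]]; split=> [i|]; apply: ltW.
have : (\int[mu d]_(x in coord_box t r) cst (f t / 2)%:E x <=
        \int[mu d]_(x in D) (f (lcoord x))%:E)%E.
  have mf A : measurable_fun A (fun x : lcarrier (leb R d) => f (lcoord x)).
    by apply: measurable_funTS; exact: measurable_polyf pf.
  apply: (@le_trans _ _ (\int[mu d]_(x in coord_box t r) (f (lcoord x))%:E)%E).
    apply: ge0_le_integral => //.
    - by move=> x _; rewrite lee_fin divr_ge0 // ltW.
    - exact/measurable_EFinP.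
    - by move=> x /rB /rP[/ltW].
  apply: ge0_subset_integral => //; first exact/measurable_EFinP.
  by move=> x /f0; rewrite lee_fin.
rewrite If0 integral_cst // [X in (_ * X <= _)%E]vB -EFinM lee_fin leNgt => /negP; apply.
by rewrite mulr_gt0 ?divr_gt0 ?exprn_gt0 ?mulrn_wgt0.
Unshelve. all: by end_near.
Qed.
End Measure.

(** * Forms with vanishing traces on the standard simplex *)

Section Division.
Variable R : realType.

(** The barycentric coordinate of the vertex 0 of the standard simplex; it vanishes
    on the facet opposite to the origin. *)
Definition lam0 d (t : 'rV[R]_d) : R := 1 - \sum_i t 0 i.
Definition set_coord d (t : 'rV[R]_d) (m : 'I_d) (c : R) : 'rV[R]_d :=
  \row_j if j == m then c else t 0 j.

Lemma polyf_monomial d (e : 'I_d -> nat) :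
  polyf (\sum_i e i)%N%:Z (fun t : 'rV[R]_d => \prod_i t 0 i ^+ e i).
Proof.
rewrite (big_morph Posz PoszD (erefl _)).
by apply: polyf_prod => i _; rewrite -[Posz _]natz; apply: polyfX; apply: polyf_coord.
Qed.

Lemma polyf_lam0 d : polyf 1 (@lam0 d).
Proof.
apply: polyfB; first exact: polyf_cst.
by apply: polyf_sum => i _; apply: polyf_coord.
Qed.

Lemma polyf_set_coord d j (f : 'rV[R]_d -> R) (m : 'I_d) (c : 'rV[R]_d -> R) :
  polyf 1 c -> polyf j f -> polyf j (fun t => f (set_coord t m (c t))).
Proof.
move=> pc; apply: (@polyf_comp R d d j f (fun t => set_coord t m (c t))) => i.
case: (eqVneq i m) => im.
  by apply: polyf_ext pc => t; rewrite mxE im eqxx.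
apply: polyf_ext (polyf_coord _ i (lexx 1)) => t.
by rewrite mxE (negPf im).
Qed.

Lemma set_coord_id d (t : 'rV[R]_d) (m : 'I_d) : set_coord t m (t 0 m) = t.
Proof. by apply/rowP => j; rewrite mxE; case: eqP => // ->. Qed.

(** Splitting the monomials according to whether they contain the m-th variable
    gives f t = f (t with t_m := 0) + t_m * g t, and the first term is zero. *)
Lemma polyf_div_coord d j (f : 'rV[R]_d -> R) (m : 'I_d) : polyf j f ->
  (forall t : 'rV[R]_d, t 0 m = 0 -> f t = 0) ->
  exists2 g, polyf (j - 1) g & forall t, f t = t 0 m * g t.
Proof.
move=> [p pj pf] f0.
pose e (w : multinom d) i := (w i - (i == m))%N.
pose g (t : 'rV[R]_d) := \sum_(w <- msupp p | (0 < w m)%N)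
  mcoeff w p * \prod_i t 0 i ^+ e w i.
exists g => [|t].
  apply: (@polyf_ext _ _ _ (fun t => \sum_(w <- msupp p | (w \in msupp p) && (0 < w m)%N)
    mcoeff w p * \prod_i t 0 i ^+ e w i)) => [t|]; first by rewrite /g [RHS]big_seq_cond.
  apply: polyf_sum => w /andP[wp wm]; apply: polyfZ.
  apply: polyfW (polyf_monomial (e w)); rewrite lerBrDr.
  apply: le_trans (allP pj _ wp); rewrite -PoszD mdegE lez_nat.
  rewrite (bigD1 m) //= [X in (_ <= X)%N](bigD1 m) //= {1}/e eqxx addnAC subnK //.
  by rewrite leq_add2l; apply: leq_sum => i _; exact: leq_subr.
have := f0 (set_coord t m 0); rewrite mxE eqxx => /(_ erefl) fz.
rewrite -[LHS]subr0 -{}fz !pf !mevalE /g mulr_sumr -sumrB [RHS]big_mkcond.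
apply: eq_bigr => w _; rewrite -mulrBr; case: ifPn => [wm|].
  rewrite mulrCA; congr (_ * _).
  rewrite [X in _ - X](bigD1 m) //= mxE eqxx expr0n eqn0Ngt wm mul0r subr0.
  rewrite (bigD1 m) //= [X in _ = _ * X](bigD1 m) //= mulrA; congr (_ * _).
    by rewrite -exprS /e eqxx subn1 prednK.
  by apply: eq_bigr => i /negPf im; rewrite /e im subn0.
rewrite -eqn0Ngt => /eqP wm.
rewrite (bigD1 m) //= [X in _ - X](bigD1 m) //= wm !expr0 !mul1r.
rewrite [X in _ - X](eq_bigr (fun i => t 0 i ^+ w i)) ?subrr ?mulr0 //.
by move=> i /negPf im; rewrite mxE im.
Qed.

Lemma set_coord_gt0 d (t : 'rV[R]_d) m i : simplex_interior t -> i != m ->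
  0 < set_coord t m 0 0 i.
Proof. by move=> [t0 _] /negPf im; rewrite mxE im. Qed.

(** Divide by the coordinates one after the other.  The quotient by t_i still
    vanishes on each remaining hyperplane t_m = 0, because t_i is nonzero on a dense
    part of that hyperplane. *)
Lemma polyf_div_coords d j (f : 'rV[R]_d -> R) (r : seq 'I_d) : uniq r -> polyf j f ->
  (forall m, m \in r -> forall t : 'rV[R]_d, t 0 m = 0 -> f t = 0) ->
  exists2 g, polyf (j - (size r)%:Z) g &
    forall t, f t = (\prod_(m <- r) t 0 m) * g t.
Proof.
elim: r j f => [|i r IH] j f /=; first by move=> _ pf _; exists f => [|t];
  rewrite ?subr0 // big_nil mul1r.
move=> /andP[ir ur] pf f0.
have [g pg fg] := polyf_div_coord pf (f0 i (mem_head _ _)).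
have [|h ph gh] := IH _ _ ur pg; last first.
  exists h => [|t]; last by rewrite fg gh mulrA big_cons.
  by apply: polyfW ph; rewrite -addn1 PoszD; lia.
move=> m mr t tm; rewrite -(set_coord_id t m) tm; move: t {tm}.
(* The restriction of g to the hyperplane t_m = 0, extended constantly in t_m,
   is again a polynomial, which can be tested inside the simplex. *)
have im : i != m by apply: contraNneq ir => ->.
have pgm : polyf (j - 1) (fun t => g (set_coord t m 0)).
  exact: (@polyf_set_coord _ _ g m (fun=> 0) (polyf_cst _ _ ler01) pg).
apply: (polyf_interior_eq0 pgm) => t ti; apply: (mulfI (lt0r_neq0 (set_coord_gt0 ti im))).
by rewrite mulr0 -fg; apply: (f0 m); rewrite ?inE ?mr ?orbT // mxE eqxx.
Qed.

Lemma lam0_set_coord d (t : 'rV[R]_d) m c : lam0 (set_coord t m c) = lam0 t + t 0 m - c.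
Proof.
rewrite /lam0 (bigD1 m) //= mxE eqxx [in RHS](bigD1 m) //=.
rewrite (eq_bigr (fun i => t 0 i)); first by ring.
by move=> i /negPf im; rewrite mxE im.
Qed.

(** The affine involution that exchanges t_m and [lam0 t] reduces this to the
    division by a coordinate. *)
Lemma polyf_div_lam0 d j (f : 'rV[R]_d -> R) (m : 'I_d) : polyf j f ->
  (forall t, lam0 t = 0 -> f t = 0) ->
  exists2 g, polyf (j - 1) g & forall t, f t = lam0 t * g t.
Proof.
move=> pf f0.
have [||g pg fg] := @polyf_div_coord d j (fun t => f (set_coord t m (lam0 t))) m.
- by apply: polyf_set_coord => //; exact: polyf_lam0.
- by move=> t tm; apply: f0; rewrite lam0_set_coord tm; ring.
exists (fun t => g (set_coord t m (lam0 t))) => [|t].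
  by apply: polyf_set_coord => //; exact: polyf_lam0.
have := fg (set_coord t m (lam0 t)); rewrite lam0_set_coord mxE eqxx => <-; congr f.
by apply/rowP => i; rewrite !mxE; case: eqP => // ->; ring.
Qed.

(** The product of the coordinates can be cancelled on the hyperplane lam0 = 0
    too: th is the affine projection onto it that changes only t_m, and it maps
    interior points to points with positive coordinates. *)
Lemma lam0_facet_cancel d j (f : 'rV[R]_d -> R) (m : 'I_d) : polyf j f ->
  (forall t : 'rV[R]_d, lam0 t = 0 -> (\prod_i t 0 i) * f t = 0) ->
  forall t, lam0 t = 0 -> f t = 0.
Proof.
move=> pf f0 t t0.
pose th (t : 'rV[R]_d) := set_coord t m (lam0 t + t 0 m).
have -> : t = th t by rewrite /th t0 add0r set_coord_id.
apply: (polyf_interior_eq0 (f := f \o th) (j := j)) => {t t0}.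
  apply: polyf_set_coord pf; apply: polyfD; [exact: polyf_lam0|exact: polyf_coord].
move=> t [t0 t1] /=; have tht i : 0 < th t 0 i.
  rewrite mxE; case: eqP => // _; apply: addr_gt0 => //.
  by rewrite subr_gt0.
have Tp : \prod_i th t 0 i != 0 by rewrite lt0r_neq0 // prodr_gt0.
by apply: (mulfI Tp); rewrite mulr0 f0 // lam0_set_coord subrr.
Qed.

(** The heart of the proof: on the standard simplex, a form whose tangential
    traces vanish on all facets and which is orthogonal to the test fields of
    degree k - d is zero.  The second hypothesis, on the radial component, is the
    condition that cuts the first-kind space out of the fields of degree k.

    The traces on the facets t_m = 0 give u_i = (prod_(m <> i) t_m) g_i.  With
    T = prod_m t_m and s = sum_i g_i, the radial component is T s, so s has degree
    at most k - d: the radial condition gains one degree over that of g_i.  The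
    trace on lam0 = 0 makes g_i - t_i s divisible by lam0, with quotient c_i of
    degree at most k - d, and summation over i gives s = sum_i c_i.  Testing
    with c itself turns the integrand into
      sum_i u_i c_i = lam0 sum_i (prod_(m <> i) t_m) c_i^2 + T s^2,
    which is nonnegative on the simplex, and whose vanishing forces c = 0. *)
Lemma zero_trace_unisolvence d (k : int) (u : 'I_d -> 'rV[R]_d -> R) :
  (forall i, polyf k (u i)) -> polyf k (fun t => \sum_i t 0 i * u i t) ->
  (forall m i, i != m -> forall t : 'rV[R]_d, t 0 m = 0 -> u i t = 0) ->
  (forall i j t, lam0 t = 0 -> u i t = u j t) ->
  (forall c : 'I_d -> 'rV[R]_d -> R, (forall i, polyf (k - d%:Z) (c i)) ->
    \int[lmeasure (leb R d)]_(t in @lcoord R d (leb R d) @^-1` @std_simplex R d)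
      (\sum_i u i (lcoord t) * c i (lcoord t)) = 0) ->
  forall i t, u i t = 0.
Proof.
move=> pu pxu u0 ul0 uc.
pose T (t : 'rV[R]_d) := \prod_i t 0 i.
have Tgt0 t : simplex_interior t -> 0 < T t by move=> [t0 _]; exact: prodr_gt0.
have lgt0 (t : 'rV[R]_d) : simplex_interior t -> 0 < lam0 t.
  by move=> [_ t1]; rewrite subr_gt0.
have /choice[g gP] : forall i, exists g, polyf (k - d%:Z + 1) g /\
    forall t, u i t = (\prod_(m | m != i) t 0 m) * g t.
  move=> i; have [|g pg ug] :=
    @polyf_div_coords d k (u i) (enum [pred m | m != i]) (enum_uniq _) (pu i).
    by move=> m; rewrite mem_enum => im; apply: u0; rewrite eq_sym.
  exists g; split=> [|t]; last by rewrite ug big_enum.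
  apply: polyfW pg; rewrite -cardE cardC1 card_ord.
  have d0 : (0 < d)%N := leq_ltn_trans (leq0n i) (ltn_ord i).
  lia.
have pg i := (gP i).1; have ug i t := (gP i).2 t.
pose s t := \sum_i g i t.
have Ts t : T t * s t = \sum_i t 0 i * u i t.
  rewrite mulr_sumr; apply: eq_bigr => i _; rewrite ug mulrA; congr (_ * _).
  by rewrite /T (bigD1 i).
have ps : polyf (k - d%:Z) s.
  have [|h ph Th] := @polyf_div_coords d k _ (enum 'I_d) (enum_uniq _) pxu.
    move=> m _ t tm; rewrite big1 // => i _.
    by case: (eqVneq i m) => [->|/u0 ->//]; rewrite ?tm ?mul0r ?mulr0.
  apply: (@polyf_ext _ _ _ h) => [t|]; last first.
    by apply: polyfW ph; rewrite size_enum_ord.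
  apply/esym/eqP; rewrite -subr_eq0; apply/eqP.
  apply: (polyf_interior_eq0 (f := fun t => s t - h t)
    (j := Num.max (k - d%:Z + 1) (k - (size (enum 'I_d))%:Z))).
    apply: polyfB; last by apply: polyfW ph; rewrite le_max lexx orbT.
    by apply: polyf_sum => i _; apply: polyfW (pg i); rewrite le_max lexx.
  move=> {}t ti; apply: (mulfI (lt0r_neq0 (Tgt0 t ti))).
  by rewrite mulrBr Ts Th big_enum subrr mulr0.
have /choice[c cP] : forall i, exists c, polyf (k - d%:Z) c /\
    forall t, g i t - t 0 i * s t = lam0 t * c t.
  move=> i; pose f t := g i t - t 0 i * s t.
  have pf : polyf (k - d%:Z + 1) f.
    apply: polyfB => //; rewrite addrC; apply: polyfM ps; exact: polyf_coord.
  have [|c pc fc] := polyf_div_lam0 i pf.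
    apply: (lam0_facet_cancel i pf) => t t0; rewrite mulrBr mulrCA Ts.
    rewrite [X in _ - X](_ : _ = t 0 i * u i t * \sum_j t 0 j).
      have -> : \sum_j t 0 j = 1 by apply/esym/eqP; rewrite -subr_eq0 -/(lam0 t) t0.
      by rewrite mulr1 ug mulrA /T (bigD1 i) //= subrr.
    rewrite -mulrA; congr (_ * _); rewrite mulr_sumr; apply: eq_bigr => j _.
    by rewrite (ul0 j i) // mulrC.
  by exists c; split=> //; apply: polyfW pc; rewrite addrK.
have pc i := (cP i).1; have gc i t := (cP i).2 t.
have sc t : s t = \sum_i c i t.
  apply/eqP; rewrite -subr_eq0; apply/eqP.
  apply: (polyf_interior_eq0 (f := fun t => s t - \sum_i c i t) (j := k - d%:Z)).
    by apply: polyfB => //; apply: polyf_sum.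
  move=> {}t ti.
  have : lam0 t * (s t - \sum_i c i t) = 0.
    rewrite mulrBr [X in _ - X]mulr_sumr.
    rewrite [X in _ - X](eq_bigr (fun i => g i t - t 0 i * s t)).
      by rewrite sumrB -mulr_suml -/(s t) /lam0; ring.
    by move=> i _; rewrite gc.
  by move/eqP; rewrite mulf_eq0 (gt_eqF (lgt0 _ ti)) => /eqP.
pose F t := \sum_i u i t * c i t.
have FE t : F t =
    lam0 t * (\sum_i (\prod_(m | m != i) t 0 m) * c i t ^+ 2) + T t * s t ^+ 2.
  have -> : T t * s t ^+ 2 = \sum_i T t * s t * c i t.
    by rewrite -mulr_sumr -sc expr2 mulrA.
  rewrite mulr_sumr -big_split /=; apply: eq_bigr => i _.
  (* Substitute g_i = lam0 c_i + t_i s in u_i. *)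
  rewrite ug (_ : g i t = lam0 t * c i t + t 0 i * s t); last by rewrite -gc subrK.
  have -> : T t = t 0 i * \prod_(m | m != i) t 0 m by rewrite /T (bigD1 i).
  by ring.
have c0 i t : c i t = 0.
  move: t; apply: polyf_interior_eq0 (pc i) _ => t ti.
  have pF : polyf (k + (k - d%:Z)) F by apply: polyf_sum => l _; exact: polyfM.
  have : F t = 0.
    apply: (polyf_integral_eq0 pF) => // [{ti}t [t0 t1]|]; last exact: uc.
    rewrite FE; apply: addr_ge0; apply: mulr_ge0;
      rewrite ?sqr_ge0 ?prodr_ge0 ?subr_ge0 //.
    by apply: sumr_ge0 => l _; rewrite mulr_ge0 ?sqr_ge0 ?prodr_ge0.
  have P0 l : 0 < \prod_(m | m != l) t 0 m by rewrite prodr_gt0 // => m _; exact: ti.1.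
  have S0 l : 0 <= (\prod_(m | m != l) t 0 m) * c l t ^+ 2.
    by rewrite mulr_ge0 ?sqr_ge0 // ltW.
  have L0 := lgt0 t ti; have T0 := ltW (Tgt0 t ti).
  move/eqP; rewrite FE paddr_eq0; last 2 first.
  - by rewrite mulr_ge0 ?(ltW L0) ?sumr_ge0.
  - by rewrite mulr_ge0 ?sqr_ge0.
  case/andP; rewrite mulf_eq0 (gt_eqF L0) /= psumr_eq0 // => /allP /(_ i).
  rewrite mem_index_enum => /(_ isT) /= + _.
  by rewrite mulf_eq0 (gt_eqF (P0 i)) /= sqrf_eq0 => /eqP.
move=> i t; rewrite ug; have := gc i t; rewrite c0 mulr0 sc big1 ?mulr0 ?subr0.
  by move=> ->; rewrite mulr0.
by move=> l _; exact: c0.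
Qed.
End Division.

(** * Pullback to a simplex in R^4 *)

Section Pullback.
Variable R : realType.
Local Notation vec := 'rV[R]_4.

Definition affine_par d (a : 'I_d.+1 -> vec) (t : 'rV[R]_d) : vec :=
  a ord0 + t *m dir_mx a.

Definition bary_weights d (t : 'rV[R]_d) (i : 'I_d.+1) : R :=
  if unlift ord0 i is Some j then t 0 j else lam0 t.

Lemma bary_weights0 d (t : 'rV[R]_d) : bary_weights t ord0 = lam0 t.
Proof. by rewrite /bary_weights unlift_none. Qed.

Lemma bary_weightsS d (t : 'rV[R]_d) j : bary_weights t (lift ord0 j) = t 0 j.
Proof. by rewrite /bary_weights liftK. Qed.

Lemma sum_bary_weights d (t : 'rV[R]_d) : \sum_i bary_weights t i = 1.
Proof.
rewrite big_ord_recl bary_weights0 (eq_bigr (fun i => t 0 i)).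
  by rewrite subrK.
by move=> i _; rewrite bary_weightsS.
Qed.

Lemma row_dir_mx d (a : 'I_d.+1 -> vec) i : row i (dir_mx a) = a (lift ord0 i) - a ord0.
Proof. exact: rowK. Qed.

Lemma affine_parE d (a : 'I_d.+1 -> vec) t :
  affine_par a t = \sum_i bary_weights t i *: a i.
Proof.
rewrite big_ord_recl bary_weights0 /affine_par mulmx_sum_row.
rewrite [in RHS](eq_bigr (fun i => t 0 i *: a (lift ord0 i))); last first.
  by move=> i _; rewrite bary_weightsS.
rewrite (eq_bigr (fun i => t 0 i *: a (lift ord0 i) - t 0 i *: a ord0)); last first.
  by move=> i _; rewrite row_dir_mx scalerBr.
by rewrite sumrB -scaler_suml scalerBl scale1r addrA addrAC.
Qed.

Lemma affine_par_weights d (a : 'I_d.+1 -> vec) (w : 'I_d.+1 -> R) : \sum_i w i = 1 ->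
  affine_par a (\row_i w (lift ord0 i)) = \sum_i w i *: a i.
Proof.
move=> w1; rewrite affine_parE !big_ord_recl; congr (_ *: _ + _).
  rewrite bary_weights0 /lam0 -w1 big_ord_recl; apply/eqP; rewrite subr_eq; apply/eqP.
  by congr (_ + _); apply: eq_bigr => i _; rewrite mxE.
by apply: eq_bigr => i _; rewrite bary_weightsS mxE.
Qed.

Lemma polyf_affine_par d (a : 'I_d.+1 -> vec) j (f : vec -> R) :
  polyf j f -> polyf j (fun t => f (affine_par a t)).
Proof.
apply: polyf_comp => l; apply: (@polyf_ext _ _ _
  (fun t => a ord0 0 l + \sum_i t 0 i * dir_mx a i l)) => [t|].
  by rewrite !mxE.
apply: polyfD; first exact: polyf_cst.
apply: polyf_sum => i _.
apply: polyf_ext (polyfZ (dir_mx a i l) (polyf_coord R i (lexx 1))) => t.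
exact: mulrC.
Qed.

Variables (k : int) (e : 'I_4 -> vec -> R).
Hypothesis pe : forall l, polyf k (e l).
Hypothesis pxe : polyf k (fun x => \sum_l x 0 l * e l x).

(** The 1-form with components e, evaluated at x on the vector v. *)
Definition pairing (x v : vec) : R := \sum_l e l x * v 0 l.

Lemma pairingB x v v' : pairing x (v - v') = pairing x v - pairing x v'.
Proof. by rewrite /pairing -sumrB; apply: eq_bigr => l _; rewrite !mxE mulrBr. Qed.

(** The pullback of the form to the affine hull of the points a i is zero.  Using
    the whole affine hull instead of the simplex makes this an algebraic
    condition, which restricts well to facets. *)
Definition trace_vanish d (a : 'I_d.+1 -> vec) := forall w : 'I_d.+1 -> R,
  \sum_i w i = 1 -> forall i j, pairing (\sum_m w m *: a m) (a i - a j) = 0.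

(** On the hyperplane where the m-th barycentric coordinate is zero, all edges
    avoiding vertex m are tangent to the opposite facet. *)
Lemma trace_vanish_facet d (a : 'I_d.+2 -> vec) (m : 'I_d.+2) (w : 'I_d.+2 -> R)
    (i j : 'I_d.+2) :
  trace_vanish (fun l => a (lift m l)) -> \sum_l w l = 1 -> w m = 0 ->
  i != m -> j != m -> pairing (\sum_l w l *: a l) (a i - a j) = 0.
Proof.
move=> tv; rewrite !(bigD1_ord m) //= => w1 wm im jm.
move: w1; rewrite wm scale0r !add0r => w1.
have [i' ->] : exists i', i = lift m i'.
  by case: (unliftP m i) im => [i' ->|->]; [exists i'|rewrite eqxx].
have [j' ->] : exists j', j = lift m j'.
  by case: (unliftP m j) jm => [j' ->|->]; [exists j'|rewrite eqxx].
exact: (tv (fun l => w (lift m l)) w1).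
Qed.

(** The pullback of a first-kind form to the standard simplex is again one: its
    radial component is that of e minus the pairing of e with the constant vector
    a_0, so it still has degree at most k.  Hence the result on the standard
    simplex applies to every face. *)
Lemma trace_vanish_step d (a : 'I_d.+2 -> vec) :
  (forall m : 'I_d.+2, trace_vanish (fun l => a (lift m l))) ->
  (forall c : 'I_d.+1 -> 'rV[R]_d.+1 -> R, (forall i, polyf (k - d.+1%:Z) (c i)) ->
    \int[lmeasure (leb R d.+1)]_(t in
        @lcoord R d.+1 (leb R d.+1) @^-1` @std_simplex R d.+1)
      (\sum_i pairing (affine_par a (lcoord t)) (row i (dir_mx a)) *
         c i (lcoord t)) = 0) ->
  trace_vanish a.
Proof.
move=> tv ho.
pose u i t := pairing (affine_par a t) (row i (dir_mx a)).
have uE i t : u i t = pairing (\sum_i bary_weights t i *: a i) (a (lift ord0 i) - a ord0).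
  by rewrite /u affine_parE row_dir_mx.
have u0 : forall i t, u i t = 0.
  apply: (@zero_trace_unisolvence _ _ k) => //.
  - move=> i; apply: polyf_sum => l _.
    apply: polyf_ext (polyfZ (row i (dir_mx a) 0 l) (polyf_affine_par a (pe l))) => t.
    by rewrite mulrC.
  - apply: (@polyf_ext _ _ _ (fun t => \sum_l affine_par a t 0 l * e l (affine_par a t)
                                 - \sum_l a ord0 0 l * e l (affine_par a t))).
      move=> t; rewrite -sumrB.
      under [RHS]eq_bigr do rewrite mulr_sumr.
      rewrite exchange_big; apply: eq_bigr => l _ /=.
      rewrite -mulrBl /affine_par [X in (X - _) * _]mxE addrAC subrr add0r !mxE mulr_suml.
      by apply: eq_bigr => i _; rewrite [row _ _ _ _]mxE; ring.
    apply: polyfB; first exact: (@polyf_affine_par _ a _ (fun x => \sum_l x 0 l * e l x)).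
    by apply: polyf_sum => l _; apply: polyfZ; apply: polyf_affine_par.
  - move=> m i im t tm; rewrite uE; apply: (trace_vanish_facet (tv (lift ord0 m))).
    + exact: sum_bary_weights.
    + by rewrite bary_weightsS.
    + by rewrite (inj_eq lift_inj).
    + by rewrite neq_lift.
  - move=> i j t l0; apply/eqP; rewrite -subr_eq0 !uE -pairingB opprB addrA subrK.
    apply/eqP; apply: (trace_vanish_facet (tv ord0)).
    + exact: sum_bary_weights.
    + by rewrite bary_weights0.
    + by rewrite eq_sym neq_lift.
    + by rewrite eq_sym neq_lift.
move=> w w1.
have V i : pairing (\sum_m w m *: a m) (a i) = pairing (\sum_m w m *: a m) (a ord0).
  case: (unliftP ord0 i) => [i'|] -> //; apply/eqP; rewrite -subr_eq0 -pairingB.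
  by rewrite -(affine_par_weights a w1) -(u0 i' (\row_i w (lift ord0 i))) /u row_dir_mx.
by move=> i j; rewrite pairingB !V subrr.
Qed.

End Pullback.

(** * Faces of the pentatope *)

(** The matrix determinant lemma: both sides are the determinant of the block
    matrix A, factored in two ways. *)
Lemma det_rank1 (R : comNzRingType) n (u : 'cV[R]_n) (v : 'rV[R]_n) :
  \det (1%:M + u *m v) = 1 + (v *m u) 0 0.
Proof.
pose A := block_mx 1%:M (- v) u 1%:M.
have A1 : A = block_mx 1%:M 0 u 1%:M *m block_mx 1%:M (- v) 0 (1%:M + u *m v).
  rewrite mulmx_block !mulmx0 !mul1mx !mul0mx !addr0 mulmx1 mulmxN.
  by rewrite addrCA addNr addr0.
have A2 : A = block_mx (1%:M + v *m u) (- v) 0 1%:M *m block_mx 1%:M 0 u 1%:M.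
  by rewrite mulmx_block !mulmx0 !mulmx1 mul1mx !add0r mulNmx addrK.
have := erefl (\det A); rewrite {1}A1 A2 !det_mulmx !det_lblock !det_ublock !det1.
by rewrite !mul1r !mulr1 => ->; rewrite det_mx11 !mxE.
Qed.

Section Faces.
Variable R : realType.
Local Notation vec := 'rV[R]_4.

Lemma pent_vertexE (v : 'I_5) j : pent_vertex R v 0 j = (v == lift ord0 j)%:R.
Proof.
rewrite /pent_vertex; case: (unliftP ord0 v) => [j' ->|->]; last first.
  by rewrite mxE (negPf (neq_lift _ _)).
by rewrite mxE eqxx (inj_eq lift_inj) eq_sym.
Qed.

(** The weights are x_0, ..., x_3 at the unit vectors, and the rest at the origin. *)
Lemma std_simplex_pentatope (x : vec) : std_simplex x -> pentatope x.
Proof.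
move=> [x0 x1]; exists (bary_weights x); split=> [i||]; last 1 first.
- apply/rowP => j; rewrite -affine_parE.
  rewrite /affine_par !mxE pent_vertexE (negPf (neq_lift _ _)) add0r (bigD1 j) //= big1.
    by rewrite !mxE !pent_vertexE eqxx (negPf (neq_lift _ _)) subr0 mulr1 addr0.
  move=> i ij; rewrite !mxE !pent_vertexE (negPf (neq_lift _ _)) subr0.
  by rewrite (inj_eq lift_inj) (negPf ij) mulr0.
- rewrite /bary_weights; case: unlift => //; by rewrite subr_ge0.
- exact: sum_bary_weights.
Qed.

(** Adding the two summands of the space leaves a field e of degree k whose radial
    component has degree k instead of k + 1.  This form of the space, unlike the
    direct sum, does not depend on the choice of the origin.  The identity
    h . x = 0 is only given on the pentatope, and extends because h is polynomial. *)
Lemma VLambda1_poly k (E : vec -> vec) : VLambda1 k E ->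
  exists e : 'I_4 -> vec -> R, [/\ forall l, polyf k%:Z (e l),
    polyf k%:Z (fun x => \sum_l x 0 l * e l x)
    & forall x, pentatope x -> forall l, E x 0 l = e l x].
Proof.
move=> [p [h [pp hh hx Eph]]].
have /choice[p' pP] : forall i, exists f : vec -> R, polyf (k%:Z - 1) f /\
    forall x, pentatope x -> p x 0 i = f x.
  move=> i; have [q qd qE] := pp i.
  by exists (fun x => meval (x 0) q); split=> //; exists q.
have /choice[h' hP] : forall i, exists f : vec -> R, polyf k%:Z f /\
    forall x, pentatope x -> h x 0 i = f x.
  move=> i; have [q qd qE] := hh i.
  exists (fun x => meval (x 0) q); split=> //; exists q => //.
  by apply: sub_all qd => m /eqP ->.
exists (fun l x => p' l x + h' l x); split.
- by move=> l; apply: polyfD (hP l).1; apply: polyfW (pP l).1; rewrite gerBl.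
- apply: (@polyf_ext _ _ _ (fun x => \sum_l x 0 l * p' l x)) => [x|].
    under [RHS]eq_bigr do rewrite mulrDr.
    rewrite big_split /= [X in _ + X](_ : _ = 0) ?addr0 //.
    move: x; apply: (@polyf_interior_eq0 _ _ (1 + k%:Z)) => [|x [x0 x1]].
      by apply: polyf_sum => l _; apply: polyfM (hP l).1; exact: polyf_coord.
    have Px : pentatope x.
      by apply: std_simplex_pentatope; split=> [i|]; apply: ltW.
    transitivity (dot (h x) x); last exact: hx.
    rewrite /dot mxE; apply: eq_bigr => l _.
    by rewrite mxE (hP l).2 // mulrC.
  apply: polyf_sum => l _; rewrite -[k%:Z](subrK 1) addrC.
  by apply: polyfM (pP l).1; exact: polyf_coord.
- by move=> x Px l; rewrite Eph // mxE (pP l).2 // (hP l).2.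
Qed.

Section OneFace.
Variables (d : nat) (s : 'I_d.+1 -> 'I_5).
Hypothesis sI : {homo s : i j / (i < j)%N}.
Let a := pent_vertex R \o s.

(** Since s increases, only the vertex s 0 of the face can be the origin; every
    other one is a unit vector, and its coordinate is the barycentric coordinate
    of that vertex on the face. *)
Lemma face_coord : exists J : 'I_d -> 'I_4, forall i, s (lift ord0 i) = lift ord0 (J i).
Proof.
suff /choice[J JP] : forall i, exists j : 'I_4, s (lift ord0 i) = lift ord0 j by exists J.
move=> i; case: (unliftP ord0 (s (lift ord0 i))) => [j ->|s0]; first by exists j.
by have := sI (_ : (ord0 < lift ord0 i)%N) => /(_ isT); rewrite s0.
Qed.

Lemma face_index_inj : injective s.
Proof.
move=> i j sij; apply: val_inj; apply/eqP; rewrite /= eqn_leq.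
by apply/andP; split; rewrite leqNgt; apply/negP => /sI; rewrite sij ltnn.
Qed.

Lemma affine_par_face_coord (J : 'I_d -> 'I_4) (t : 'rV[R]_d) i :
  (forall i, s (lift ord0 i) = lift ord0 (J i)) -> affine_par a t 0 (J i) = t 0 i.
Proof.
move=> sJ; rewrite affine_parE summxE (bigD1 (lift ord0 i)) //= big1 => [|l li].
  by rewrite mxE bary_weightsS pent_vertexE sJ eqxx mulr1 addr0.
by rewrite mxE pent_vertexE -sJ (inj_eq face_index_inj) (negPf li) mulr0.
Qed.

Lemma affine_par_pentatope t : std_simplex t -> pentatope (affine_par a t).
Proof.
move=> [t0 t1]; apply: std_simplex_pentatope; rewrite affine_parE.
have b0 i : 0 <= bary_weights t i.
  by rewrite /bary_weights; case: unlift => //; rewrite subr_ge0.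
split=> [l|].
  rewrite summxE; apply: sumr_ge0 => i _.
  by rewrite mxE pent_vertexE mulr_ge0 ?ler0n.
under eq_bigr do rewrite summxE.
rewrite exchange_big -(sum_bary_weights t) /=; apply: ler_sum => i _.
under eq_bigr do rewrite mxE pent_vertexE.
rewrite -mulr_sumr ler_piMr //.
case: (unliftP ord0 (s i)) => [j|] ->.
  rewrite (bigD1 j) //= eqxx big1 ?addr0 // => l lj.
  by rewrite (inj_eq lift_inj) eq_sym (negPf lj).
by rewrite big1 ?ler01 // => l _; rewrite (negPf (neq_lift _ _)).
Qed.

(** The edge vectors are either distinct unit vectors, or distinct unit vectors
    minus one further unit vector b; the Gram matrix is the identity plus |b|^2
    times the all-ones matrix. *)
Lemma gram_gt0 : 0 < \det (dir_mx a *m (dir_mx a)^T).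
Proof.
have [J sJ] := face_coord.
pose b (l : 'I_4) : R := (s ord0 == lift ord0 l)%:R.
have bJ i : b (J i) = 0.
  by rewrite /b -sJ (inj_eq face_index_inj) (negPf (neq_lift _ _)).
have JI : injective J.
  by move=> i i' /(congr1 (lift ord0)); rewrite -!sJ => /face_index_inj /lift_inj.
pose B := \sum_l b l * b l.
have DE i l : dir_mx a i l = (J i == l)%:R - b l.
  by rewrite !mxE !pent_vertexE sJ (inj_eq lift_inj).
have dE i (f : 'I_4 -> R) : \sum_l (J i == l)%:R * f l = f (J i).
  rewrite (bigD1 (J i)) //= eqxx mul1r big1 ?addr0 // => l.
  by rewrite eq_sym => /negPf ->; rewrite mul0r.
have -> : dir_mx a *m (dir_mx a)^T = 1%:M + const_mx B *m (const_mx 1 : 'rV_d).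
  apply/matrixP => i i'; rewrite !mxE big_ord1 !mxE mulr1.
  rewrite (eq_bigr (fun l => (J i == l)%:R * ((J i' == l)%:R - b l)
      - (J i' == l)%:R * b l + b l * b l)); last first.
    by move=> l _; rewrite [_^T _ _]mxE !DE; ring.
  rewrite big_split sumrB /= !dE !bJ !subr0 (inj_eq JI).
  by rewrite eq_sym.
rewrite det_rank1 ltr_wpDr // mxE sumr_ge0 // => i _.
by rewrite !mxE mul1r sumr_ge0 // => l _; rewrite mulr_ge0 // ler0n.
Qed.

(** The tangent field on the face with components c in the basis of edge vectors
    and in the barycentric parametrization, extended polynomially to R^4. *)
Definition face_field (J : 'I_d -> 'I_4) (c : 'I_d -> 'rV[R]_d -> R) (x : vec) : vec :=
  (\row_i c i (\row_m x 0 (J m))) *m dir_mx a.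

Lemma polyf_face_field J c j : (forall i, polyf j (c i)) ->
  forall l, polyf j (fun x => face_field J c x 0 l).
Proof.
move=> pc l; apply: (@polyf_ext _ _ _
  (fun x => \sum_i dir_mx a i l * c i (\row_m x 0 (J m)))) => [x|].
  by rewrite /face_field mxE; apply: eq_bigr => i _; rewrite [(\row__ _) _ _]mxE mulrC.
apply: polyf_sum => i _; apply: polyfZ.
apply: (@polyf_comp _ _ _ _ (c i) (fun x : vec => \row_m x 0 (J m))); last exact: pc.
by move=> m; apply: polyf_ext (polyf_coord R (J m) (lexx 1)) => x; rewrite mxE.
Qed.

(** The surface measure factor is a positive constant, so it can be dropped. *)
Lemma face_dof_pullback (E : vec -> vec) (e : 'I_4 -> vec -> R) J c :
  (forall x, pentatope x -> forall l, E x 0 l = e l x) ->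
  (forall i, s (lift ord0 i) = lift ord0 (J i)) ->
  int_simplex a (fun x => dot (E x) (face_field J c x)) = 0 ->
  \int[lmeasure (leb R d)]_(t in @lcoord R d (leb R d) @^-1` @std_simplex R d)
      (\sum_i pairing e (affine_par a (lcoord t)) (row i (dir_mx a)) *
         c i (lcoord t)) = 0.
Proof.
move=> Ee sJ /eqP; rewrite mulf_eq0 sqrtr_eq0 leNgt gram_gt0 /= => /eqP I0.
rewrite -[RHS]I0; apply: eq_Rintegral => t /set_mem St.
rewrite -/(affine_par a (lcoord t)) /dot mxE.
have tE : \row_m affine_par a (lcoord t) 0 (J m) = lcoord t.
  by apply/rowP => m; rewrite mxE affine_par_face_coord.
rewrite [RHS](eq_bigr (fun l =>
  \sum_i e l (affine_par a (lcoord t)) * dir_mx a i l * c i (lcoord t))).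
  rewrite [RHS]exchange_big; apply: eq_bigr => i _ /=.
  by rewrite /pairing mulr_suml; apply: eq_bigr => l _; rewrite [row _ _ _ _]mxE.
move=> l _; rewrite Ee; last exact: affine_par_pentatope.
rewrite [_^T _ _]mxE /face_field tE [(_ *m _) _ _]mxE mulr_sumr.
by apply: eq_bigr => i _; rewrite [(\row_i _) _ _]mxE; ring.
Qed.

End OneFace.

Lemma homo_lift d (s : 'I_d.+2 -> 'I_5) (m : 'I_d.+2) :
  {homo s : i j / (i < j)%N} -> {homo (fun i => s (lift m i)) : i j / (i < j)%N}.
Proof.
move=> sI i j ij; apply: sI; rewrite /= /bump.
by move: (nat_of_ord i) (nat_of_ord j) (nat_of_ord m) ij; lia.
Qed.

Lemma polyf_is_poly j (A : set vec) f : polyf j f -> is_poly j A f.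
Proof. by move=> [p pj pf]; exists p. Qed.

Section Dofs.
Variables (k : nat) (E : vec -> vec) (e : 'I_4 -> vec -> R).
Hypothesis hd : dofs_vanish k E.
Hypothesis pe : forall l, polyf k%:Z (e l).
Hypothesis pxe : polyf k%:Z (fun x => \sum_l x 0 l * e l x).
Hypothesis Ee : forall x, pentatope x -> forall l, E x 0 l = e l x.

(** For edges, the test functions are scalar and paired with the unit tangent;
    scaling them by the length of the edge gives the same integrals as tangent
    fields do. *)
Lemma face_dofs d (s : 'I_d.+2 -> 'I_5) (J : 'I_d.+1 -> 'I_4) c :
  {homo s : i j / (i < j)%N} -> (d < 3)%N ->
  (forall i, polyf (k%:Z - d.+1%:Z) (c i)) ->
  int_simplex (@pent_vertex R \o s) (fun x => dot (E x) (face_field s J c x)) = 0.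
Proof.
move=> sI d3 pc; have [h1 h2 h3 h4] := hd.
have sf : is_face (@pent_vertex R \o s) by exists s.
have pq A : is_poly_field (k%:Z - d.+1%:Z) A (face_field s J c).
  by move=> l; apply: polyf_is_poly; exact: polyf_face_field.
have tq : tangent_field (@pent_vertex R \o s) (face_field s J c).
  by move=> x _; exact: submxMl.
case: d d3 s J c sI pc sf pq tq => [|[|[|//]]] _ s J c sI pc sf pq tq.
- pose v := @pent_vertex R (s ord_max) - pent_vertex R (s ord0).
  have vE : dir_mx (@pent_vertex R \o s) = v.
    apply/rowP => l; rewrite /dir_mx !mxE /=.
    by congr (pent_vertex _ (s _) _ _ - _); apply: val_inj.
  have v0 : 0 < dot v v.
    by have := gram_gt0 sI; rewrite det_mx11 vE.
  rewrite -[RHS](h1 _ sf (fun x => Num.sqrt (dot v v) * c 0 (\row_m x 0 (J m)))).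
    congr int_simplex; apply/funext => x.
    have -> : face_field s J c x = c 0 (\row_m x 0 (J m)) *: v.
      by apply/rowP => l; rewrite /face_field vE mxE big_ord1 !mxE.
    have dotZ r : dot (E x) (r *: v) = r * dot (E x) v.
      by rewrite /dot linearZ -scalemxAr mxE.
    rewrite /unit_tangent /= -/v !dotZ.
    by field; rewrite gt_eqF // sqrtr_gt0.
  apply: polyf_is_poly; apply: polyfZ.
  apply: (@polyf_comp _ _ _ _ (c 0) (fun x : vec => \row_m x 0 (J m))) => // m.
  by apply: polyf_ext (polyf_coord R (J m) (lexx 1)) => x; rewrite mxE.
- exact: h2.
- exact: h3.
Qed.

(** Induction over the dimension of the face: its facets are faces again, and on
    a vertex there is no tangential trace. *)
Lemma face_traces_vanish d (s : 'I_d.+1 -> 'I_5) : (d < 4)%N ->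
  {homo s : i j / (i < j)%N} -> trace_vanish e (@pent_vertex R \o s).
Proof.
elim: d s => [|d IH] s d4 sI; first by move=> w _ i j; rewrite !ord1 pairingB subrr.
have [J sJ] := face_coord sI.
apply: (trace_vanish_step pe pxe) => [m|c pc].
  exact: (IH (fun i => s (lift m i)) (ltnW d4) (homo_lift m sI)).
by apply: (face_dof_pullback sI Ee sJ); exact: face_dofs.
Qed.

Lemma pentatope_trace_vanish : trace_vanish e (@pent_vertex R).
Proof.
have sI : {homo (@idfun 'I_5) : i j / (i < j)%N} by [].
have [J sJ] := face_coord sI.
apply: (trace_vanish_step pe pxe) => [m|c pc].
  exact: (face_traces_vanish (s := fun i => lift m i) _ (homo_lift m sI)).
apply: (face_dof_pullback sI Ee sJ); have [_ _ _ h4] := hd.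
by apply: h4 => l; apply: polyf_is_poly; exact: polyf_face_field.
Qed.

End Dofs.
End Faces.

Theorem theorem4p7 (R : realType) (k : nat) (hk : (1 <= k)%N)
    (E : 'rV[R]_4 -> 'rV[R]_4) (hE : VLambda1 k E) (hdofs : dofs_vanish k E) :
  forall x : 'rV[R]_4, pentatope x -> E x = 0.
Proof.
move=> x Px; have [e [pe pxe Ee]] := VLambda1_poly hE.
have [w [_ w1 xE]] := Px.
apply/rowP => l; rewrite Ee // [RHS]mxE.
have := pentatope_trace_vanish hdofs pe pxe Ee w1 (lift ord0 l) ord0.
rewrite -xE => pairing0; rewrite -[RHS]pairing0.
rewrite /pairing (bigD1 l) //= big1 => [|l' ll'].
  by rewrite !mxE !pent_vertexE eqxx (negPf (neq_lift _ _)) subr0 mulr1 addr0.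
rewrite !mxE !pent_vertexE (negPf (neq_lift _ _)) subr0 (inj_eq lift_inj).
by rewrite eq_sym (negPf ll') mulr0.
Qed.
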